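(* Let $\ell\ge 1$ be a real number and let $k:[1,\infty)\to(0,\infty)$ be a positive increasing function. Let $W(\ell;k)$ be the set of natural numbers $n$ with $|\sigma(n)-\ell n|<k(n)$. Let $D$ be the distribution function of $\sigma(n)/n$, extended to $\mathbb{R}$ by $D(u)=0$ for $u<1$. (a) If $k(n)=o(n)$, then $W(\ell;k)$ has asymptotic density $0$. (b) If $k(n)\sim cn$ for some $c>0$, then $W(\ell;k)$ has asymptotic density $D(\ell+c)-D(\ell-c)$. (c) If $k(n)\asymp n$, then $W(\ell;k)$ has positive lower density and upper density strictly less than $1$. (d) If $n=o(k(n))$, then $W(\ell;k)$ has asymptotic density $1$.
   Context: $\sigma(n)$ is the sum of all positive divisors of $n$. By Davenport's theorem, $\sigma(n)/n$ has a continuous, strictly increasing distribution function $D$ on $[1,\infty)$, i.e. $\lim_{x\to\infty}\frac1x\#\{n\le x:\sigma(n)/n\le u\}=D(u)$. $f\asymp g$ means there are positive constants $c_1,c_2$ with $c_1g<f<c_2g$ for all sufficiently large arguments. *)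

(* Defs.v *)
From HB Require Import structures.
From mathcomp Require Import all_boot all_order all_algebra.
From mathcomp Require Import all_classical all_reals all_analysis.

Set Implicit Arguments.
Unset Strict Implicit.
Unset Printing Implicit Defensive.

Import Order.TTheory GRing.Theory Num.Theory.
Import numFieldNormedType.Exports.

Local Open Scope classical_set_scope.
Local Open Scope ring_scope.

Definition sigma (n : nat) : nat := (\sum_(d <- divisors n) d)%N.

(* The counting function A(x) = #{1 <= n <= x : n \in A} for real x >= 0. *)
Definition counting (R : realType) (A : set nat) (x : R) : nat :=
  (\sum_(1 <= n < (Num.truncn x).+1) (n \in A))%N.

Definition prop_upto (R : realType) (A : set nat) (x : R) : R :=
  (counting A x)%:R / x.

Definition has_density (R : realType) (A : set nat) (d : R) : Prop :=
  prop_upto A (N%:R : R) @[N --> \oo] --> d.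

(* Both sequences of proportions are bounded, so the real-valued
   limn_inf and limn_sup are the usual lim inf and lim sup. *)
Definition lower_density (R : realType) (A : set nat) : R :=
  limn_inf (fun N : nat => prop_upto A (N%:R : R)).

Definition upper_density (R : realType) (A : set nat) : R :=
  limn_sup (fun N : nat => prop_upto A (N%:R : R)).

(* The distribution function of sigma(n)/n, extended by 0 to u < 1.  For u >= 1
   it is defined as the value of the limit, which exists by Davenport's theorem;
   neither existence, continuity nor strict monotonicity is assumed. *)
Definition sigma_distr (R : realType) (u : R) : R :=
  if u < 1 then 0
  else lim (prop_upto [set n : nat | (sigma n)%:R / n%:R <= u] x
              @[x --> +oo%R]).

Definition within_perfect (R : realType) (l : R) (k : R -> R) : set nat :=
  [set n : nat | (0 < n)%N /\ `|(sigma n)%:R - l * n%:R| < k n%:R].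

Definition asymp (R : realType) (f g : nat -> R) : Prop :=
  exists c1 c2 : R, [/\ 0 < c1, 0 < c2 &
    \forall n \near \oo, c1 * g n < f n /\ f n < c2 * g n].

(* Main.v *)
(** Write f(n) = sigma(n)/n.  Averaging f - f_y, where f_y only keeps the
    divisors up to y and is periodic, shows that the level sets of f are
    approximated by periodic sets, as soon as f has no concentration: the upper
    density of { |f - u| <= delta } tends to 0 with delta.  For the latter, take
    a finite set of primes p >= p0 whose sum of reciprocals is large.  By a
    sieve, almost every n is p m with one of these p and p not dividing m; then
    f(n) = (1 + 1/p) f(m), and for a given m at most one p can put f(n) in a
    short interval, so that at most a proportion 1/p0 of the n qualify.
    Positivity of the density of { |f - l| < c } comes from the multiples
    m (1 + y! j) of some m with f(m) in (l - c, l], since f(1 + y! j) is close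
    to 1 on average. *)

Require Import Defs.
From HB Require Import structures.
From mathcomp Require Import all_boot all_order all_algebra.
From mathcomp Require Import all_classical all_reals all_analysis.
From mathcomp Require Import zify ring lra.

Set Implicit Arguments.
Unset Strict Implicit.
Unset Printing Implicit Defensive.

Import Order.TTheory GRing.Theory Num.Theory.
Import numFieldNormedType.Exports.

Local Open Scope classical_set_scope.
Local Open Scope ring_scope.

(** * Counting integers up to N, and divisor sums of products *)

Definition count_upto (P : pred nat) (N : nat) : nat :=
  (\sum_(1 <= n < N.+1) P n)%N.

Lemma count_uptoS P N : count_upto P N.+1 = (count_upto P N + P N.+1)%N.
Proof. by rewrite /count_upto big_nat_recr. Qed.

Lemma count_upto0 P : count_upto P 0 = 0%N.
Proof. by rewrite /count_upto big_geq. Qed.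

Lemma count_upto_dvdn d N : (0 < d)%N -> count_upto (dvdn d) N = (N %/ d)%N.
Proof.
move=> d0; elim: N => [|N IH]; first by rewrite count_upto0 div0n.
by rewrite count_uptoS IH divnS // addnC.
Qed.

(** A divisor d of mn is the product of gcd(d, m), which divides m, and d / gcd(d, m), which divides
    n; so it occurs among the products of a divisor of m and one of n. *)
Lemma sigma_mul_le m n : (0 < m)%N -> (0 < n)%N ->
  (sigma (m * n) <= sigma m * sigma n)%N.
Proof.
move=> m0 n0; rewrite /sigma big_distrlr /=.
rewrite -(big_allpairs_dep (h := muln) (F := id)).
apply: sub_le_big_seq => [//|x y|d]; first exact: leq_addr.
rewrite count_uniq_mem ?divisors_uniq //.
have [|//] := boolP (d \in divisors (m * n)).
rewrite -dvdn_divisors ?muln_gt0 ?m0 // => dmn.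
rewrite -has_count; apply/hasP; exists d; last by rewrite /= eqxx.
apply/allpairsP; exists (gcdn d m, d %/ gcdn d m)%N => /=.
have g0 : (0 < gcdn d m)%N by rewrite gcdn_gt0 m0 orbT.
split; last by rewrite mulnC divnK // dvdn_gcdl.
  by rewrite -dvdn_divisors // dvdn_gcdr.
rewrite -dvdn_divisors //.
rewrite -(@Gauss_dvdr _ (m %/ gcdn d m)).
  by rewrite -(dvdn_pmul2l g0) mulnA ![(gcdn d m * (_ %/ _))%N]mulnC
     !divnK // ?dvdn_gcdl ?dvdn_gcdr.
rewrite /coprime -(eqn_pmul2l g0) muln1 muln_gcdr.
by rewrite ![(gcdn d m * (_ %/ _))%N]mulnC !divnK // ?dvdn_gcdl ?dvdn_gcdr.
Qed.

(** The divisors of pm are those of m and their multiples by p; the two lists are disjoint because p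
    does not divide m. *)
Lemma sigma_prime_mul p m : prime p -> (0 < m)%N -> ~~ (p %| m)%N ->
  sigma (p * m) = (p.+1 * sigma m)%N.
Proof.
move=> pp m0 pm; have p0 := prime_gt0 pp.
have P : perm_eq (divisors (p * m))
    (divisors m ++ [seq (p * d)%N | d <- divisors m]).
  apply: uniq_perm; first exact: divisors_uniq.
    rewrite cat_uniq divisors_uniq map_inj_uniq ?divisors_uniq ?andbT /=.
      apply/hasPn => x /mapP[d _ ->]; rewrite -dvdn_divisors //.
      by apply: contra pm; apply: dvdn_trans; apply: dvdn_mulr.
    by move=> x y /eqP; rewrite eqn_pmul2l // => /eqP.
  move=> d; rewrite mem_cat -!dvdn_divisors ?muln_gt0 ?p0 //.
  apply/idP/orP => [dpm|[dm|/mapP[e]]].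
  - have [pd|pd] := boolP (p %| d)%N; last first.
      by left; rewrite -(@Gauss_dvdr _ p) // coprime_sym prime_coprime.
    right; apply/mapP; exists (d %/ p)%N; last by rewrite mulnC divnK.
    by rewrite -dvdn_divisors // -(dvdn_pmul2l p0) mulnC divnK.
  - exact: dvdn_mull.
  - by rewrite -dvdn_divisors // => em ->; rewrite dvdn_pmul2l.
by rewrite /sigma (perm_big _ P) big_cat big_map -big_distrr /= mulSn.
Qed.

(** * The ratio sigma(n)/n as a sum of reciprocals of divisors *)

Section Abundancy.
Variable R : realType.

Definition abundancy (n : nat) : R := (sigma n)%:R / n%:R.

(** The involution d -> n/d turns the terms d/n into 1/d. The range of summation does not depend on
    n, so that sums over n and over d can be exchanged. *)
Lemma abundancyE N n : (0 < n <= N)%N ->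
  abundancy n = \sum_(1 <= d < N.+1) (d %| n)%:R * d%:R^-1.
Proof.
move=> /andP[n0 nN]; have nR : n%:R != 0 :> R by rewrite pnatr_eq0 -lt0n.
rewrite /abundancy /sigma natr_sum mulr_suml.
transitivity (\sum_(d <- divisors n) d%:R^-1 : R).
  have P : perm_eq (divisors n) [seq (n %/ d)%N | d <- divisors n].
    have U : uniq [seq (n %/ d)%N | d <- divisors n].
      rewrite map_inj_in_uniq ?divisors_uniq // => x y.
      rewrite -!dvdn_divisors // => xn yn e.
      have q0 : (0 < n %/ x)%N.
        by rewrite divn_gt0; [exact: dvdn_leq|exact: (dvdn_gt0 n0)].
      apply/eqP; rewrite -(eqn_pmul2l q0) (divnK xn).
      by rewrite [X in (X * y)%N]e (divnK yn).
    apply: uniq_perm => //; first exact: divisors_uniq.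
    move=> d; rewrite -dvdn_divisors //; apply/idP/mapP => [dn|[e]].
      exists (n %/ d)%N; first by rewrite -dvdn_divisors // dvdn_div.
      by rewrite divnA // mulKn.
    by rewrite -dvdn_divisors // => en ->; rewrite dvdn_div.
  rewrite (perm_big _ P) big_map /= !big_seq; apply: eq_bigr => d.
  rewrite -dvdn_divisors // => dn.
  have dR : d%:R != 0 :> R by rewrite pnatr_eq0 -lt0n (dvdn_gt0 n0).
  by rewrite natr_div ?unitfE // mulrAC divff // mul1r.
rewrite [RHS](bigID (fun d => (d %| n)%N)) /= [X in _ + X]big1 ?addr0; last first.
  by move=> d /negbTE ->; rewrite mul0r.
under [RHS]eq_bigr => d -> do rewrite mul1r.
rewrite -[RHS]big_filter; apply: perm_big; apply: uniq_perm.
- exact: divisors_uniq.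
- exact/filter_uniq/iota_uniq.
move=> d; rewrite -dvdn_divisors // mem_filter mem_index_iota ltnS.
have [dn|//] := boolP (d %| n)%N.
by rewrite (dvdn_gt0 n0 dn) (leq_trans (dvdn_leq n0 dn)).
Qed.

Lemma abundancy_ge1 n : (0 < n)%N -> 1 <= abundancy n.
Proof.
move=> n0; rewrite (@abundancyE n) ?n0 ?leqnn // big_nat_recl // dvd1n.
by rewrite invr1 mulr1 lerDl sumr_ge0 // => d _; rewrite mulr_ge0 ?invr_ge0.
Qed.

Lemma abundancy_mul_le m n : (0 < m)%N -> (0 < n)%N ->
  abundancy (m * n) <= abundancy m * abundancy n.
Proof.
move=> m0 n0; rewrite /abundancy mulrACA -invfM -!natrM.
by rewrite ler_wpM2r ?invr_ge0 // ler_nat sigma_mul_le.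
Qed.

Lemma abundancy_prime_mul p m : prime p -> (0 < m)%N -> ~~ (p %| m)%N ->
  abundancy (p * m) = (1 + p%:R^-1) * abundancy m.
Proof.
move=> pp m0 pm; rewrite /abundancy sigma_prime_mul // !natrM -natr1.
field; rewrite !pnatr_eq0 -!lt0n m0; exact: prime_gt0.
Qed.

Lemma le_abundancy_mul m n : (0 < m)%N -> (0 < n)%N ->
  abundancy m <= abundancy (m * n).
Proof.
move=> m0 n0.
have h : (0 < m <= m * n)%N by rewrite m0 leq_pmulr.
have h' : (0 < m * n <= m * n)%N by rewrite muln_gt0 m0 n0 leqnn.
rewrite (abundancyE h) (abundancyE h').
apply: ler_sum => d _; rewrite ler_wpM2r ?invr_ge0 // ler_nat.
by have [dm|//] := boolP (d %| m)%N; rewrite dvdn_mulr.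
Qed.

(* Comparison with the telescoping sum of [1/(d-1) - 1/d]. *)
Lemma sum_inv_sq_le y N : (0 < y)%N ->
  \sum_(y.+1 <= d < N.+1) d%:R^-1 * d%:R^-1 <= y%:R^-1 :> R.
Proof.
move=> y0; have [Ny|yN] := ltnP N y.+1.
  by rewrite big_geq // invr_ge0.
suff : \sum_(y.+1 <= d < N.+1) d%:R^-1 * d%:R^-1 <= y%:R^-1 - N%:R^-1 :> R.
  by move/le_trans; apply; rewrite gerBl invr_ge0.
have -> : (N = y + (N - y))%N by lia.
elim: (N - y)%N => [|k IH]; first by rewrite addn0 big_geq // subrr.
rewrite addnS big_nat_recr /=; last by rewrite ltnS leq_addr.
apply: le_trans (lerD IH (lexx _)) _.
set a := (y + k)%N; have a0 : (0 < a)%N by rewrite /a addn_gt0 y0.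
have aR : 0 < a%:R :> R by rewrite ltr0n.
rewrite -natr1 -subr_ge0.
have -> : y%:R^-1 - (a%:R + 1)^-1 -
    (y%:R^-1 - a%:R^-1 + (a%:R + 1)^-1 / (a%:R + 1)) =
    (a%:R * (a%:R + 1) ^+2)^-1 :> R.
  by move: (y%:R^-1) => b; field; apply/andP; split; apply/lt0r_neq0; lra.
by rewrite invr_ge0 mulr_ge0 ?sqr_ge0 // ltW.
Qed.

End Abundancy.

(** * Comparing and splitting counts *)

Lemma count_upto_size P N : count_upto P N = size [seq n <- iota 1 N | P n].
Proof.
rewrite /count_upto size_filter -sum1_count [RHS]big_mkcond.
by rewrite /index_iota subn1.
Qed.

Lemma count_upto_le_card (T : finType) (P : pred nat) N (h : nat -> T) :
  {in [pred n | (0 < n <= N)%N && P n] &, injective h} ->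
  (count_upto P N <= #|T|)%N.
Proof.
move=> hI; rewrite count_upto_size -(size_map h).
have /card_uniqP <- : uniq [seq h n | n <- [seq n <- iota 1 N | P n]].
  rewrite map_inj_in_uniq ?filter_uniq ?iota_uniq // => x y.
  rewrite !mem_filter !mem_iota => /andP[Px xN] /andP[Py yN].
  by apply: hI; rewrite inE ?Px ?Py andbT; lia.
exact: max_card.
Qed.

Lemma count_upto_subadd (P Q S : pred nat) N :
  (forall n, (0 < n <= N)%N -> P n -> Q n || S n) ->
  (count_upto P N <= count_upto Q N + count_upto S N)%N.
Proof.
move=> PQS; rewrite /count_upto -big_split /= big_nat [leqRHS]big_nat.
apply: leq_sum => n nN; have := PQS n.
by case: (P n) (Q n) (S n) => [] [] [] // /(_ _ isT) h; apply: h; lia.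
Qed.

Lemma leq_count_upto (P Q : pred nat) N :
  (forall n, (0 < n <= N)%N -> P n -> Q n) ->
  (count_upto P N <= count_upto Q N)%N.
Proof.
move=> PQ; rewrite /count_upto big_nat [leqRHS]big_nat.
apply: leq_sum => n nN; have := PQ n.
by case: (P n) (Q n) => [] [] // /(_ _ isT) h; apply: h; lia.
Qed.

Lemma count_upto_leq P N : (count_upto P N <= N)%N.
Proof.
rewrite count_upto_size size_filter.
by rewrite (leq_trans (count_size _ _)) ?size_iota.
Qed.

Lemma count_uptoD P m n :
  count_upto P (m + n) =
    (count_upto P m + count_upto (fun k => P (m + k)%N) n)%N.
Proof.
elim: n => [|n IH]; first by rewrite addn0 count_upto0 addn0.
by rewrite addnS !count_uptoS IH addnA addnS.
Qed.

Lemma eq_count_upto (P Q : pred nat) N :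
  (forall n, (0 < n <= N)%N -> P n = Q n) -> count_upto P N = count_upto Q N.
Proof.
move=> PQ; rewrite /count_upto big_nat [RHS]big_nat.
by apply: eq_bigr => n nN; rewrite PQ.
Qed.

(** * Divergence of the sum of the reciprocals of the primes *)

Section PrimeReciprocals.
Variable R : realType.

(** A smooth number is determined by its exponents at the primes below K, and each exponent is at
    most L. *)
Lemma count_smooth K L :
  (count_upto (fun n => all (ltn^~ K) (primes n)) (2 ^ L) <= L.+1 ^ K)%N.
Proof.
have -> : (L.+1 ^ K)%N = #|{: {ffun 'I_K -> 'I_L.+1}}|.
  by rewrite card_ffun !card_ord.
pose h n := [ffun i : 'I_K => inord (logn i n) : 'I_L.+1].
apply: (@count_upto_le_card _ _ _ h) => m n.
rewrite !inE => /andP[/andP[m0 mL] mK] /andP[/andP[n0 nL] nK] /ffunP hmn.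
have logL p k : (0 < k)%N -> (k <= 2 ^ L)%N -> (logn p k <= L)%N.
  move=> k0 kL; have [->//|e0] := posnP (logn p k).
  rewrite -(@leq_exp2l 2) //; apply: leq_trans kL.
  apply: leq_trans (dvdn_leq k0 (pfactor_dvdnn p k)).
  rewrite leq_exp2r //; apply: prime_gt1.
  by move: e0; rewrite logn_gt0 mem_primes => /andP[].
apply: eqn_from_log => // p.
have [pK|Kp] := ltnP p K.
  have := hmn (Ordinal pK); rewrite !ffunE /= => /(congr1 val) /=.
  by rewrite !inordK ?ltnS ?logL.
have lz k : all (ltn^~ K) (primes k) -> logn p k = 0%N.
  move=> /allP kK; apply/eqP; rewrite -leqn0 leqNgt logn_gt0.
  by apply/negP => /kK /=; rewrite ltnNge Kp.
by rewrite !lz.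
Qed.

Lemma exists_pow_gt K : exists L : nat, (2 * L.+1 ^ K <= 2 ^ L)%N.
Proof.
(* With L + 1 = 2^j the claim becomes j K + 2 <= 2^j; the even exponent j = 2 a makes the right side
   the square of 2^a > a. *)
pose a := (2 * K + 2)%N; pose j := (2 * a)%N.
have h : (j * K + 2 <= 2 ^ j)%N.
  have h1 : (a < 2 ^ a)%N by apply: ltn_expl.
  have -> : (2 ^ j = (2 ^ a) ^ 2)%N by rewrite /j mulnC expnM.
  apply: (@leq_trans (a.+1 ^ 2)); last by rewrite leq_exp2r.
  by rewrite /j /a; nia.
exists (2 ^ j).-1; rewrite prednK ?expn_gt0 // -expnM -expnS leq_exp2l //.
by move: h; move: (j * K)%N (2 ^ j)%N => Y X; lia.
Qed.

(* Erdős: an integer up to [2 ^ L] is either [K]-smooth, and there are few of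
   those, or a multiple of some prime [p >= K]. *)
Lemma sum_prime_inv_block K : exists z,
  (K <= z)%N /\ 2%:R^-1 <= \sum_(K <= p < z | prime p) p%:R^-1 :> R.
Proof.
have [L hL] := exists_pow_gt K.
exists (maxn K (2 ^ L).+1); split; first exact: leq_maxl.
set z := maxn _ _.
have cover : (2 ^ L <= L.+1 ^ K +
    \sum_(K <= p < z | prime p) count_upto (dvdn p) (2 ^ L))%N.
  apply: leq_trans (leq_add (count_smooth K L) (leqnn _)).
  rewrite [leqLHS](_ : _ = count_upto predT (2 ^ L)); last first.
    by rewrite count_upto_size filter_predT size_iota.
  rewrite /count_upto exchange_big /= -big_split /= big_nat [leqRHS]big_nat.
  apply: leq_sum => n /andP[n0 nL].
  have [//|/allPn[p]] := boolP (all _ _).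
  rewrite mem_primes -leqNgt => /and3P[pp _ pn] Kp.
  rewrite add0n big_mkcond (bigD1_seq p) ?iota_uniq /= ?pp ?pn //.
  rewrite mem_index_iota Kp leq_max; apply/orP; right.
  by rewrite ltnS; apply: leq_trans (dvdn_leq n0 pn) _.
have X0 : 0 < (2 ^ L)%:R :> R by rewrite ltr0n expn_gt0.
have : (2 ^ L)%:R <= 2%:R^-1 * (2 ^ L)%:R +
    (2 ^ L)%:R * \sum_(K <= p < z | prime p) p%:R^-1 :> R.
  apply: le_trans (_ : (L.+1 ^ K)%:R +
    (\sum_(K <= p < z | prime p) count_upto (dvdn p) (2 ^ L))%:R <= _).
    by rewrite -natrD ler_nat.
  apply: lerD.
    by rewrite mulrC ler_pdivlMr // mulrC -natrM ler_nat.
  rewrite mulr_sumr natr_sum; apply: ler_sum => p pp.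
  rewrite count_upto_dvdn ?prime_gt0 // ler_pdivlMr ?ltr0n ?prime_gt0 //.
  by rewrite -natrM ler_nat leq_divM.
move: (\sum_(K <= p < z | _) _) (_%:R) X0 => s X X0.
nra.
Qed.

(** Consecutive blocks, each contributing at least 1/2, are joined. *)
Lemma sum_prime_inv_unbounded K (C : R) : exists z,
  (K <= z)%N /\ C <= \sum_(K <= p < z | prime p) p%:R^-1.
Proof.
have block c : exists z, (K <= z)%N /\
    c%:R / 2%:R <= \sum_(K <= p < z | prime p) p%:R^-1 :> R.
  elim: c => [|c [z [Kz hz]]].
    by exists K; split => //; rewrite big_geq // mul0r.
  have [y [zy hy]] := sum_prime_inv_block z.
  exists y; split; first exact: leq_trans zy.
  by rewrite (big_cat_nat Kz zy) /= -natr1; lra.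
have [z [Kz hz]] := block (2 * (Num.truncn C).+1)%N.
exists z; split => //; apply: le_trans hz.
by rewrite natrM mulrAC divff ?mul1r ?pnatr_eq0 // ltW // truncnS_gt.
Qed.

End PrimeReciprocals.

(** * Periodic sets and the Chinese remainder theorem *)

Section Periodic.

Definition periodic_pred (P : pred nat) (M : nat) :=
  forall n, P (n + M)%N = P n.

Lemma periodic_predM P M q : periodic_pred P M -> periodic_pred P (q * M).
Proof.
by move=> PM; elim: q => [|q IH] n; rewrite ?addn0 // mulSn addnCA addnC PM IH.
Qed.

Lemma periodic_modn P M n : periodic_pred P M -> P (n %% M)%N = P n.
Proof. by move=> PM; rewrite {2}(divn_eq n M) addnC (periodic_predM _ PM). Qed.

Lemma count_upto_periodic P M q : periodic_pred P M ->
  count_upto P (q * M) = (q * count_upto P M)%N.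
Proof.
move=> PM; elim: q => [|q IH]; first exact: count_upto0.
rewrite mulSn count_uptoD mulSn -IH; congr addn.
by apply: eq_count_upto => n _; rewrite addnC PM.
Qed.

(** Full periods cancel exactly; what remains is a difference of two numbers between 0 and M. *)
Lemma count_upto_periodic_dist (R : realType) P M N : periodic_pred P M ->
  (0 < M)%N ->
  `|(count_upto P N)%:R - N%:R * ((count_upto P M)%:R / M%:R)| <= M%:R :> R.
Proof.
move=> PM M0; have MR : 0 < M%:R :> R by rewrite ltr0n.
rewrite {1 2}(divn_eq N M) count_uptoD count_upto_periodic //.
set s := count_upto _ (N %% M); set c := count_upto P M.
have sM : (s <= M)%N.
  by rewrite (leq_trans (count_upto_leq _ _)) // ltnW // ltn_pmod.
have cM : (c <= M)%N := count_upto_leq _ _.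
have rM : (N %% M <= M)%N by rewrite ltnW // ltn_pmod.
have -> : (N %/ M * c + s)%:R - (N %/ M * M + N %% M)%:R * (c%:R / M%:R) =
    s%:R - (N %% M)%:R * (c%:R / M%:R) :> R.
  by rewrite !natrD !natrM; field; rewrite lt0r_neq0.
have h0 : 0 <= (N %% M)%:R * (c%:R / M%:R) :> R by rewrite mulr_ge0 ?divr_ge0.
have h1 : (N %% M)%:R * (c%:R / M%:R) <= M%:R :> R.
  rewrite -[leRHS]mulr1 ler_pM ?divr_ge0 ?ler_nat //.
  by rewrite ler_pdivrMr // mul1r ler_nat.
have s0 : 0 <= s%:R :> R by [].
have s1 : s%:R <= M%:R :> R by rewrite ler_nat.
by rewrite ler_norml; apply/andP; split; lra.
Qed.

(** By periodicity the residue 0 takes the place of M, so that counts become sums over residues. *)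
Lemma count_upto_ord P M : periodic_pred P M ->
  count_upto P M = (\sum_(i < M) P i)%N.
Proof.
case: M => [|M] PM; first by rewrite count_upto0 big_ord0.
have P0 : P M.+1 = P 0%N by rewrite -[M.+1]add0n PM.
rewrite count_uptoS P0 big_ord_recl addnC; congr addn.
by rewrite /count_upto big_add1 /= big_mkord; apply: eq_bigr.
Qed.

(** Reduction modulo M and modulo N is a bijection from the residues modulo MN to pairs of
    residues. *)
Lemma count_upto_coprime P Q M N : coprime M N -> (0 < M)%N -> (0 < N)%N ->
  periodic_pred P M -> periodic_pred Q N ->
  count_upto (fun n => P n && Q n) (M * N) =
    (count_upto P M * count_upto Q N)%N.
Proof.
move=> coMN M0 N0 PM QN.
rewrite (count_upto_ord PM) (count_upto_ord QN) count_upto_ord; last first.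
  by move=> n; rewrite mulnC periodic_predM // mulnC periodic_predM.
rewrite big_distrlr /= pair_big /=.
pose h (k : 'I_(M * N)) :=
  (Ordinal (ltn_pmod k M0), Ordinal (ltn_pmod k N0)).
rewrite (reindex h) /=.
  by apply: eq_bigr => k _; rewrite !periodic_modn // mulnb.
apply/onW_bij/inj_card_bij; last by rewrite card_prod !card_ord.
move=> x y [] xM xN; apply/val_inj => /=.
have /eqP := chinese_remainder coMN x y.
by rewrite xM xN !eqxx /= !modn_small // => /eqP/eqP.
Qed.

End Periodic.

(** * The abundancy does not concentrate near a point *)

Section Concentration.
Variable R : realType.

(** Exactness makes n / p prime to p, where sigma is multiplicative, and depends only on n modulo
    p^2. *)
Definition exactly_dvdn (p n : nat) := (p %| n)%N && ~~ (p ^ 2 %| n)%N.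

Definition no_exact_divisor (ps : seq nat) (n : nat) :=
  all (fun p => ~~ exactly_dvdn p n) ps.

Lemma periodic_not_exactly_dvdn p :
  periodic_pred (fun n => ~~ exactly_dvdn p n) (p ^ 2).
Proof. by move=> n; rewrite /exactly_dvdn !dvdn_addl // dvdn_mulr. Qed.

(** Of the p^2 residues, p are multiples of p and one of these is 0, so p - 1 are removed. The
    additive form avoids truncated subtraction. *)
Lemma count_not_exactly_dvdn p : (0 < p)%N ->
  (count_upto (fun n => ~~ exactly_dvdn p n) (p ^ 2) + p = p ^ 2 + 1)%N.
Proof.
move=> p0; have p2 : (0 < p ^ 2)%N by rewrite expn_gt0 p0.
transitivity (count_upto predT (p ^ 2) + count_upto (dvdn (p ^ 2)) (p ^ 2))%N.
  rewrite -[X in (_ + X)%N](mulnK p p0) mulnn -count_upto_dvdn //.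
  rewrite /count_upto -!big_split; apply: eq_bigr => n _ /=.
  rewrite /exactly_dvdn; have [pn|pn] := boolP (p %| n)%N.
    by case: (_ %| _)%N.
  have /negbTE -> // : ~~ (p ^ 2 %| n)%N.
  by apply: contra pn; apply: dvdn_trans; apply: dvdn_mulr.
by rewrite count_upto_dvdn // divnn p2 count_upto_size filter_predT size_iota.
Qed.

(** One more prime P leaves e = P^2 - P + 1 classes modulo P^2, and the induction reduces to e / (2
    P) <= P - 1. *)
Lemma sieve_step (P e c s M : R) : 2 <= P -> 0 <= c -> 0 <= s ->
  e + P = P ^+ 2 + 1 -> c * (1 + s) <= M ->
  e * c * (1 + ((2 * P)^-1 + s)) <= P ^+ 2 * M.
Proof.
move=> P2 c0 s0 eP cM.
have -> : e = P ^+ 2 - P + 1 by lra.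
have b0 : 0 < (2 * P)^-1 by rewrite invr_gt0; lra.
have bP : (2 * P)^-1 * P = 2^-1 by field; apply/lt0r_neq0; lra.
move: (2 * P)^-1 b0 bP => b b0 bP.
apply: le_trans (_ : P ^+ 2 * (c * (1 + s)) <= _); last first.
  by rewrite ler_wpM2l // sqr_ge0.
rewrite mulrAC mulrC [leRHS]mulrCA ler_wpM2l //.
have h : (P ^+ 2 - P + 1) * b <= P - 1.
  have -> : (P ^+ 2 - P + 1) * b = b * P * P - b * P + b by ring.
  rewrite bP; have : b <= 4^-1 by nra.
  lra.
have : 0 <= (P - 1) * s by rewrite mulr_ge0 // subr_ge0; lra.
nra.
Qed.

(* The density of the sifted set is the product of the
   [1 - (p - 1) / p ^ 2 <= 1 - 1 / (2 p)], and
   [prod (1 - a_i) <= 1 / (1 + sum a_i)]. *)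
Lemma count_no_exact_divisor (ps : seq nat) (M := (\prod_(p <- ps) p ^ 2)%N) :
  uniq ps -> all prime ps ->
  periodic_pred (no_exact_divisor ps) M /\
  (count_upto (no_exact_divisor ps) M)%:R *
    (1 + \sum_(p <- ps) (2 * p%:R)^-1) <= M%:R :> R.
Proof.
rewrite {}/M; elim: ps => [|p ps IH] /=.
  by rewrite !big_nil addr0 mulr1 ler_nat count_upto_leq.
move=> /andP[pps ups] /andP[pp aps]; have [per cnt] := IH ups aps.
have p0 := prime_gt0 pp.
have M0 : (0 < \prod_(p <- ps) p ^ 2)%N.
  rewrite big_seq prodn_cond_gt0 // => q /(allP aps) /prime_gt0 q0.
  by rewrite expn_gt0 q0.
have co : coprime (p ^ 2) (\prod_(p <- ps) p ^ 2).
  rewrite big_seq; apply: (big_ind (coprime (p ^ 2))); first exact: coprimen1.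
    by move=> x y px py; rewrite coprimeMr px.
  move=> q qps; rewrite coprimeXl // coprimeXr // prime_coprime //.
  rewrite dvdn_prime2 ?(allP aps _ qps) //.
  by apply: contraNneq pps => ->.
rewrite !big_cons; split.
  move=> n; congr andb.
    by rewrite mulnC (periodic_predM _ (@periodic_not_exactly_dvdn p)).
  exact: (periodic_predM (p ^ 2) per).
rewrite (count_upto_coprime co) ?expn_gt0 ?p0 //; last first.
  exact: periodic_not_exactly_dvdn.
rewrite natrM [leRHS]natrM [(p ^ 2)%:R]natrX; apply: sieve_step cnt => //.
- by rewrite ler_nat prime_gt1.
- by apply: sumr_ge0 => q _; rewrite invr_ge0 mulr_ge0.
- by rewrite -natrX natr1 -natrD count_not_exactly_dvdn // addn1.
Qed.

(* A set on which the abundancy is almost constant meets [{p m | p in ps}] at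
   most once for each [m], up to non-exact divisors: the ratios [1 + 1/p] are
   separated. *)
Lemma count_concentrated_exact (u delta : R) (ps : seq nat) p0 z N :
  (0 < p0)%N -> all prime ps -> all (fun p => p0 <= p < z)%N ps ->
  2 * delta * (z%:R * z%:R) < 1 ->
  (count_upto (fun n => (`|abundancy R n - u| <= delta)%R &&
      ~~ no_exact_divisor ps n) N <= (N %/ p0).+1)%N.
Proof.
move=> p00 aps apz dz.
(* The first prime of [ps] dividing n exactly; the default 0 is taken only when there is none. *)
pose pk n := head 0%N [seq p <- ps | exactly_dvdn p n].
have pkP n : ~~ no_exact_divisor ps n ->
    [/\ prime (pk n), (p0 <= pk n < z)%N & exactly_dvdn (pk n) n].
  rewrite /pk -has_predC => /hasP[q qps qn].
  have : q \in [seq p <- ps | exactly_dvdn p n].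
    by rewrite mem_filter qps andbT -[exactly_dvdn q n]negbK.
  case E : [seq p <- ps | exactly_dvdn p n] => [//|r s] _ /=.
  have : r \in [seq p <- ps | exactly_dvdn p n] by rewrite E mem_head.
  rewrite mem_filter => /andP[rn rps].
  by rewrite (allP aps _ rps) (allP apz _ rps).
rewrite -[leqRHS]card_ord.
(* The injection sends n to its cofactor [n %/ pk n], which is at most N / p0. *)
apply: (@count_upto_le_card _ _ _ (fun n => inord (n %/ pk n))) => x y.
have decomp n : (0 < n)%N -> ~~ no_exact_divisor ps n ->
    [/\ (0 < n %/ pk n)%N, n = (pk n * (n %/ pk n))%N &
      abundancy R n = (1 + (pk n)%:R^-1) * abundancy R (n %/ pk n)].
  move=> n0 /pkP[pp _ /andP[pn p2n]].
  have e : n = (pk n * (n %/ pk n))%N by rewrite mulnC divnK.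
  have q0 : (0 < n %/ pk n)%N by move: n0; rewrite {1}e muln_gt0 => /andP[].
  split=> //; rewrite {1}e abundancy_prime_mul //.
  by apply: contra p2n => pq; rewrite {2}e dvdn_pmul2l // prime_gt0.
rewrite !inE => /andP[/andP[x0 xN] /andP[fx nx]].
move=> /andP[/andP[y0 yN] /andP[fy ny]] /(congr1 val) /=.
have [ppx pxz _] := pkP _ nx; have [ppy pyz _] := pkP _ ny.
rewrite !inordK ?ltnS; last 2 first.
- apply: leq_trans (leq_div2r _ yN) _; apply: leq_div2l => //; by case/andP: pyz.
- apply: leq_trans (leq_div2r _ xN) _; apply: leq_div2l => //; by case/andP: pxz.
have [mx0 ex ax] := decomp _ x0 nx; have [my0 ey ay] := decomp _ y0 ny.
move=> mxy; suff pxy : pk x = pk y by rewrite ex ey mxy pxy.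
(* If q < p, the two values differ by A (p - q) / (p q) >= 1 / z^2 > 2 delta, so they cannot both
   lie within delta of u. *)
have sep (p q : nat) (A : R) : (0 < p < z)%N -> (0 < q < z)%N -> 1 <= A ->
    `|(1 + p%:R^-1) * A - u| <= delta -> `|(1 + q%:R^-1) * A - u| <= delta ->
    (p <= q)%N.
  move=> /andP[p1 pz] /andP[q1 qz] A1 fp fq; rewrite leqNgt; apply/negP => qp.
  have Rq : 0 < q%:R :> R by rewrite ltr0n.
  have Rp : 0 < p%:R :> R by rewrite ltr0n.
  have Rqp : q%:R + 1 <= p%:R :> R by rewrite natr1 ler_nat.
  have gap : (1 + q%:R^-1) * A - (1 + p%:R^-1) * A <= 2 * delta.
    by move: fp fq; rewrite !ler_norml => /andP[? ?] /andP[? ?]; lra.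
  have gap2 : (p%:R * q%:R)^-1 <= (1 + q%:R^-1) * A - (1 + p%:R^-1) * A :> R.
    have -> : (1 + q%:R^-1) * A - (1 + p%:R^-1) * A =
        (p%:R - q%:R) * A * (p%:R * q%:R)^-1 :> R.
      by field; rewrite !lt0r_neq0.
    rewrite ler_peMl ?invr_ge0 ?mulr_ge0 //; nra.
  have pq0 : 0 < p%:R * q%:R :> R by rewrite mulr_gt0.
  have pqz : p%:R * q%:R <= z%:R * z%:R :> R.
    by rewrite ler_pM // ler_nat ltnW.
  have : 1 <= 2 * delta * (p%:R * q%:R).
    by rewrite -ler_pdivrMr // mul1r (le_trans gap2).
  have d0 : 0 <= delta by rewrite (le_trans _ fp).
  have : 2 * delta * (p%:R * q%:R) <= 2 * delta * (z%:R * z%:R).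
    by rewrite ler_wpM2l // mulr_ge0.
  lra.
have pkz n : (p0 <= n < z)%N -> (0 < n < z)%N.
  by case/andP=> pn ->; rewrite (leq_trans p00 pn).
rewrite ax in fx; rewrite ay -mxy in fy.
apply/eqP; rewrite eqn_leq; apply/andP; split.
- by apply: (sep _ _ _ _ _ _ fx fy); rewrite ?pkz // abundancy_ge1.
- by apply: (sep _ _ _ _ _ _ fy fx); rewrite ?pkz // abundancy_ge1.
Qed.

Lemma abundancy_concentration (u eps : R) : 0 < eps ->
  exists2 delta : R, 0 < delta & exists C : R, forall N,
    (count_upto (fun n => `|abundancy R n - u| <= delta) N)%:R
      <= eps * N%:R + C.
Proof.
(* Chosen so that the proportion 1/p0 is at most eps/2. *)
move=> e0; pose p0 := (Num.truncn (2 / eps)).+1.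
have p0e : p0%:R^-1 <= eps / 2.
  rewrite -[eps / 2]invrK lef_pV2 ?posrE ?invr_gt0 ?divr_gt0 ?ltr0n //.
  by rewrite invf_div ltW // truncnS_gt.
(* Each prime enters the sieve with weight 1/(2 p), so 4/eps here becomes 2/eps there, and the
   sifted set has density at most eps/2. *)
have [z [p0z hz]] := sum_prime_inv_unbounded p0 (4 / eps).
pose ps := [seq p <- index_iota p0 z | prime p].
have ups : uniq ps by rewrite filter_uniq ?iota_uniq.
have aps : all prime ps by apply: filter_all.
have [per cnt] := count_no_exact_divisor ups aps.
set M := (\prod_(p <- ps) p ^ 2)%N in per cnt.
have M0 : (0 < M)%N.
  rewrite /M big_seq prodn_cond_gt0 // => q /(allP aps) /prime_gt0 q0.
  by rewrite expn_gt0 q0.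
have apz : all (fun p => p0 <= p < z)%N ps.
  by apply/allP => p; rewrite mem_filter mem_index_iota => /andP[].
have zz : 0 < z%:R * z%:R :> R by rewrite mulr_gt0 // ltr0n (leq_trans _ p0z).
(* This gives 2 delta z^2 = 1/2, below the separation threshold 1. *)
exists (4 * (z%:R * z%:R))^-1; first by rewrite invr_gt0 mulr_gt0.
(* M pays for the incomplete period of the sieve, 1 for the successor in [(N %/ p0).+1]. *)
exists (M%:R + 1) => N.
set S := fun n : nat => _.
have dens : (count_upto (no_exact_divisor ps) M)%:R / M%:R <= eps / 2 :> R.
  rewrite ler_pdivrMr ?ltr0n //.
  have : 2 / eps <= \sum_(p <- ps) (2 * p%:R)^-1 :> R.
    rewrite /ps big_filter; under eq_bigr => p _ do rewrite invfM.
    by rewrite -mulr_sumr; move: hz; lra.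
  move: cnt; move: (\sum_(_ <- _) _) => s cnt hs.
  have : (count_upto (no_exact_divisor ps) M)%:R * (2 / eps) <= M%:R :> R.
    by apply: le_trans cnt; rewrite ler_wpM2l //; lra.
  by rewrite mulrA ler_pdivrMr // => h; lra.
have h1 : (count_upto (no_exact_divisor ps) N)%:R <= N%:R * (eps / 2) + M%:R :> R.
  have := count_upto_periodic_dist R N per M0.
  rewrite ler_norml => /andP[_].
  have : N%:R * ((count_upto (no_exact_divisor ps) M)%:R / M%:R) <= N%:R * (eps / 2) :> R.
    by rewrite ler_wpM2l.
  lra.
have h2 : (count_upto (fun n => S n && ~~ no_exact_divisor ps n) N)%:R
    <= N%:R * (eps / 2) + 1 :> R.
  apply: le_trans (_ : (N %/ p0).+1%:R <= _).
    rewrite ler_nat; apply: count_concentrated_exact apz _ => //.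
    rewrite invfM -!mulrA mulVf ?lt0r_neq0 // mulr1; lra.
  rewrite -natr1 lerD2r; apply: le_trans (_ : N%:R * p0%:R^-1 <= _).
    by rewrite ler_pdivlMr ?ltr0n // -natrM ler_nat leq_divM.
  by rewrite ler_wpM2l.
have : (count_upto S N)%:R <=
    (count_upto (no_exact_divisor ps) N)%:R +
    (count_upto (fun n => S n && ~~ no_exact_divisor ps n) N)%:R :> R.
  rewrite -natrD ler_nat; apply: count_upto_subadd => n _ ->.
  by case: (no_exact_divisor ps n).
lra.
Qed.

End Concentration.

(** * Truncation to small divisors and approximation by periodic sets *)

Section Distribution.
Variable R : realType.

Lemma count_upto_markov (g : nat -> R) N (B delta : R) : 0 < delta ->
  (forall n, (0 < n <= N)%N -> 0 <= g n) ->
  \sum_(1 <= n < N.+1) g n <= B ->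
  (count_upto (fun n => delta < g n) N)%:R <= B / delta.
Proof.
move=> d0 g0 gB; rewrite ler_pdivlMr //; apply: le_trans gB.
rewrite /count_upto natr_sum mulr_suml !big_nat; apply: ler_sum => n nN.
have [/ltW|_] := ltP delta (g n); first by rewrite mul1r.
by rewrite mul0r g0.
Qed.

Definition truncated_abundancy (y n : nat) : R :=
  \sum_(1 <= d < y.+1) (d %| n)%:R * d%:R^-1.

Lemma abundancy_truncatedE y n N : (0 < n <= N)%N -> (y <= N)%N ->
  abundancy R n - truncated_abundancy y n =
    \sum_(y.+1 <= d < N.+1) (d %| n)%:R * d%:R^-1.
Proof.
move=> nN yN; rewrite (abundancyE R nN) /truncated_abundancy.
by rewrite (@big_cat_nat _ _ _ y.+1) //= addrAC subrr add0r.
Qed.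

Lemma truncated_abundancy_le y n : (0 < n)%N ->
  truncated_abundancy y n <= abundancy R n.
Proof.
move=> n0; rewrite -subr_ge0 (@abundancy_truncatedE y n (n + y)) ?leq_addl //.
  by apply: sumr_ge0 => d _; rewrite mulr_ge0 ?invr_ge0.
by rewrite n0 leq_addr.
Qed.

(** After the exchange of sums, each d > y divides at most N/d of the n and so contributes at most
    N/d^2. *)
Lemma sum_abundancy_tail y N : (0 < y)%N ->
  \sum_(1 <= n < N.+1) (abundancy R n - truncated_abundancy y n)
    <= N%:R / y%:R.
Proof.
move=> y0; pose K := (N + y)%N.
have -> : \sum_(1 <= n < N.+1) (abundancy R n - truncated_abundancy y n) =
    \sum_(1 <= n < N.+1) \sum_(y.+1 <= d < K.+1) (d %| n)%:R * d%:R^-1.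
  rewrite big_nat [RHS]big_nat; apply: eq_bigr => n /andP[n0].
  rewrite ltnS => nN.
  by rewrite (@abundancy_truncatedE y n K) ?leq_addl // n0 (leq_trans nN) ?leq_addr.
rewrite exchange_big /=.
apply: le_trans (ler_wpM2l (ler0n _ N) (sum_inv_sq_le R K y0)).
rewrite mulr_sumr big_nat [leRHS]big_nat; apply: ler_sum => d /andP[yd _].
rewrite -mulr_suml mulrA ler_wpM2r ?invr_ge0 //.
have d0 : (0 < d)%N by apply: leq_trans yd.
rewrite -natr_sum -/(count_upto _ _) count_upto_dvdn //.
by rewrite ler_pdivlMr ?ltr0n // -natrM ler_nat leq_divM.
Qed.

(** The truncation at y = 1 is the constant 1, so Markov's inequality applies to f - 1, whose mean
    is at most 1. *)
Lemma count_abundancy_gt N (A : R) : 0 < A ->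
  (count_upto (fun n => 1 + A < abundancy R n) N)%:R <= N%:R / A.
Proof.
move=> A0; have t1 n : truncated_abundancy 1 n = 1.
  by rewrite /truncated_abundancy big_nat1 dvd1n mul1r invr1.
have := @sum_abundancy_tail 1 N isT; rewrite divr1 => S1.
apply: le_trans (count_upto_markov A0 _ S1).
  by rewrite ler_nat; apply: leq_count_upto => n _; rewrite t1; lra.
by move=> n /andP[n0 _]; rewrite subr_ge0 truncated_abundancy_le.
Qed.

Lemma periodic_truncated_abundancy y u :
  periodic_pred (fun n => truncated_abundancy y n <= u) y`!.
Proof.
move=> n /=; congr (_ <= _); rewrite /truncated_abundancy.
rewrite big_nat [RHS]big_nat; apply: eq_bigr => d /andP[d0 dy].
by rewrite dvdn_addl // dvdn_fact // d0.
Qed.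

(** Since f_y <= f, only the n with f_y(n) <= u < f(n) are miscounted; for these the tail f - f_y
    exceeds delta or f(n) is within delta of u. *)
Lemma count_abundancy_approx (u eps : R) : 0 < eps ->
  exists d C : R, forall N,
    `|(count_upto (fun n => abundancy R n <= u) N)%:R - d * N%:R|
      <= eps * N%:R + C.
Proof.
move=> e0; have e2 : 0 < eps / 2 by rewrite divr_gt0.
have [delta d0 [C hC]] := abundancy_concentration u e2.
(* Makes the Markov bound N / (y delta) at most eps N / 2. *)
pose y := (Num.truncn (2 / (delta * eps))).+1.
pose M := y`!; have M0 : (0 < M)%N := fact_gt0 y.
pose P n := truncated_abundancy y n <= u.
exists ((count_upto P M)%:R / M%:R), (C + M%:R) => N.
have /(count_upto_periodic_dist R N) /(_ M0) := @periodic_truncated_abundancy y u.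
rewrite -/P -/M => hP.
have le1 : (count_upto (fun n => abundancy R n <= u) N)%:R <= (count_upto P N)%:R :> R.
  rewrite ler_nat; apply: leq_count_upto => n /andP[n0 _].
  by apply: le_trans; apply: truncated_abundancy_le.
pose E1 n := delta < abundancy R n - truncated_abundancy y n.
pose E2 n := `|abundancy R n - u| <= delta.
have le2 : (count_upto P N)%:R <=
    (count_upto (fun n => abundancy R n <= u) N)%:R +
    ((count_upto E1 N)%:R + (count_upto E2 N)%:R) :> R.
  apply: le_trans (_ : (count_upto (fun n => abundancy R n <= u) N)%:R +
    (count_upto (fun n => E1 n || E2 n) N)%:R <= _).
    rewrite -natrD ler_nat; apply: count_upto_subadd => n _.
    rewrite /P /E1 /E2 => tu.
    have [//|un] := leP (abundancy R n) u; have [//|ad] := ltP delta _ => /=.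
    by rewrite ler_norml; apply/andP; split; lra.
  by rewrite lerD2l -natrD ler_nat; apply: count_upto_subadd.
have hE1 : (count_upto E1 N)%:R <= eps / 2 * N%:R :> R.
  apply: le_trans (count_upto_markov d0 _ (sum_abundancy_tail N _)) _ => //.
    by move=> n /andP[n0 _]; rewrite subr_ge0 truncated_abundancy_le.
  have -> : N%:R / y%:R / delta = (y%:R * delta)^-1 * N%:R by rewrite invfM; ring.
  rewrite ler_wpM2r //.
  rewrite -[eps / 2]invrK lef_pV2 ?posrE ?invr_gt0 ?mulr_gt0 ?ltr0n //.
  rewrite invf_div -ler_pdivrMr //.
  by rewrite -mulrA -invfM [eps * _]mulrC ltW // truncnS_gt.
have := hC N; rewrite -/E2; move: hP le1 le2 hE1.
move: (count_upto _ _)%:R (count_upto P N)%:R (count_upto E1 N)%:R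
  (count_upto E2 N)%:R => a b e1 e2'.
by rewrite !ler_norml [_ * N%:R]mulrC => /andP[h1 h2] h3 h4 h5 h6;
  apply/andP; split; lra.
Qed.

(** * The abundancy along the progression 1 + y! j *)

Lemma leq_count_upto_comp (P : pred nat) (h : nat -> nat) J :
  (forall i j, (i < j)%N -> (h i < h j)%N) ->
  (count_upto (fun j => P (h j)) J <= count_upto P (h J))%N.
Proof.
move=> hmono; elim: J => [|J IH]; first by rewrite count_upto0.
have hJ := hmono _ _ (ltnSn J).
case e : (h J.+1) hJ => [//|k]; rewrite ltnS => hk.
rewrite !count_uptoS e leq_add2r; apply: leq_trans IH _.
by rewrite -(subnKC hk) count_uptoD leq_addr.
Qed.

(** The first K terms are at most 1, the later ones at most 1/K. This stands in for the logarithm,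
    with a slope 1/K that can be chosen. *)
Lemma sum_inv_le K X : (0 < K)%N ->
  \sum_(1 <= d < X.+1) d%:R^-1 <= K%:R + X%:R / K%:R :> R.
Proof.
move=> K0; elim: X => [|X IH].
  by rewrite big_geq // mul0r addr0.
rewrite big_nat_recr //=.
have [XK|KX] := leqP X.+1 K; last first.
  rewrite -natr1 mulrDl addrA natr1 lerD // mul1r lef_pV2 ?posrE ?ltr0n //.
  by rewrite ler_nat ltnW.
rewrite -big_nat_recr //; apply: le_trans (_ : K%:R <= _); last first.
  by rewrite lerDl divr_ge0.
apply: le_trans (_ : X.+1%:R <= _); last by rewrite ler_nat.
rewrite -[X in _ <= X%:R]subn0 -[(X.+1 - 0)%N]/(X.+2 - 1)%N.
rewrite -[leRHS]sumr_const_nat !big_nat; apply: ler_sum => d /andP[d0 _].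
by rewrite invf_le1 ?ltr0n // ler1n.
Qed.

(** All elements lie in one class modulo d, so the quotient by d determines them. *)
Lemma count_upto_progression (P : pred nat) d J : (0 < d)%N ->
  (forall i j, (i <= j)%N -> P i -> P j -> (d %| j - i)%N) ->
  (count_upto P J <= (J %/ d).+1)%N.
Proof.
move=> d0 Pd; rewrite -[leqRHS]card_ord.
apply: (@count_upto_le_card _ _ _ (fun j => inord (j %/ d))) => i j.
rewrite !inE => /andP[/andP[_ iJ] Pi] /andP[/andP[_ jJ] Pj] /(congr1 val) /=.
rewrite !inordK ?ltnS ?leq_div2r // => ij.
wlog le_ij : i j iJ Pi jJ Pj ij / (i <= j)%N.
  by move=> H; case/orP: (leq_total i j) => h; [|symmetry]; apply: H.
have := Pd _ _ le_ij Pi Pj; rewrite (divn_eq i d) (divn_eq j d) ij.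
rewrite -eqn_mod_dvd; last first.
  by rewrite -ij -divn_eq ij -divn_eq.
by rewrite !modnMDl !modn_mod => /eqP ->.
Qed.

(* A divisor [d > 1] of [1 + y! j] exceeds [y]. *)
Lemma sum_abundancy_progression y J : (0 < y)%N ->
  \sum_(1 <= j < J.+1) (abundancy R (1 + y`! * j) - 1) <=
    2 * (J%:R / y%:R) + (y`! * y).+2%:R.
Proof.
move=> y0; set M := y`!; have M0 : (0 < M)%N := fact_gt0 y.
pose X := (1 + M * J)%N.
have -> : \sum_(1 <= j < J.+1) (abundancy R (1 + M * j) - 1) =
  \sum_(1 <= j < J.+1) \sum_(y.+1 <= d < (X + y).+1) (d %| 1 + M * j)%:R * d%:R^-1.
  rewrite big_nat [RHS]big_nat; apply: eq_bigr => j /andP[j0 jJ].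
  rewrite -(@abundancy_truncatedE y) ?leq_addl //; last first.
    by rewrite /= (leq_trans _ (leq_addr _ _)) // leq_add2l leq_mul2l -ltnS jJ orbT.
  congr (_ - _); rewrite /truncated_abundancy big_ltn // dvd1n invr1 mulr1.
  rewrite big_nat big1 ?addr0 // => d /andP[d1 dy].
  have dM : (d %| M * j)%N by rewrite dvdn_mulr // dvdn_fact // (ltnW d1).
  by rewrite dvdn_addl // dvdn1 gtn_eqF // mul0r.
rewrite exchange_big /=.
apply: le_trans (_ : \sum_(y.+1 <= d < (X + y).+1)
  (J%:R * (d%:R^-1 * d%:R^-1) + d%:R^-1) <= _).
  rewrite big_nat [leRHS]big_nat; apply: ler_sum => d /andP[yd _].
  have d0 : (0 < d)%N by apply: leq_trans yd.
  rewrite -mulr_suml mulrA -[X in _ <= _ + X]mul1r -mulrDl.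
  rewrite ler_wpM2r ?invr_ge0 // -natr_sum -/(count_upto _ _).
  (* If d divides some 1 + y! j, it is prime to y!, so all such j lie in one class modulo d. The
     successor in this bound is the source of the harmonic sum. *)
  apply: le_trans (_ : ((J %/ d).+1)%:R <= _).
    rewrite ler_nat; apply: count_upto_progression => // i j ij di dj.
    have coMd : coprime d M.
      rewrite /coprime -dvdn1; have := dvdn_trans (dvdn_gcdl d M) di.
      by rewrite dvdn_addl // dvdn_mulr // dvdn_gcdr.
    rewrite -(Gauss_dvdr _ coMd) mulnBr -(subnDl 1).
    exact: dvdn_sub.
  rewrite -natr1 lerD2r ler_pdivlMr ?ltr0n // -natrM ler_nat; exact: leq_divM.
rewrite big_split /= -mulr_sumr mulr2n mulrDl mul1r -addrA.
apply: lerD; first by rewrite ler_wpM2l // sum_inv_sq_le.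
apply: le_trans (_ : \sum_(1 <= d < (X + y).+1) d%:R^-1 <= _).
  rewrite [leRHS](@big_cat_nat _ _ _ y.+1) ?ltnS ?leq_addl //= lerDr.
  by apply: sumr_ge0 => d _; rewrite invr_ge0.
(* With the cut at y! y, the slope 1 / (y! y) turns the length 1 + y! J + y into J / y plus at most
   2. *)
have My : (0 < M * y)%N by rewrite muln_gt0 M0.
apply: le_trans (sum_inv_le _ My) _.
have yR : 0 < y%:R :> R by rewrite ltr0n.
have y1 : 1 <= y%:R :> R by rewrite ler1n.
have MR : 1 <= M%:R :> R by rewrite ler1n.
rewrite /X -2!natr1 !natrD !natrM -[y in X in _ <= X]/y.
have -> : (1 + M%:R * J%:R + y%:R) / (M%:R * y%:R) =
    J%:R / y%:R + (1 + y%:R) / (M%:R * y%:R) :> R.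
  by field; rewrite !lt0r_neq0 //; lra.
have : (1 + y%:R) / (M%:R * y%:R) <= 2 :> R.
  rewrite ler_pdivrMr; last by nra.
  nra.
lra.
Qed.

End Distribution.

(** * Abundancies near a given value, and densities *)

Section Density.
Variable R : realType.

(* Multiply up the primes [p >= K], with [l / K < c], until the abundancy
   exceeds [l]; each factor [1 + 1/p] moves it by at most [l / K]. *)
Lemma exists_abundancy_near (l c : R) : 1 <= l -> 0 < c ->
  exists2 m, (0 < m)%N & l - c < abundancy R m <= l.
Proof.
move=> l1 c0; pose K := (Num.truncn (l / c)).+1.
pose Q z := (\prod_(K <= p < z | prime p) p)%N.
have Q0 z : (0 < Q z)%N by apply: prodn_cond_gt0 => p /prime_gt0.
have QK : abundancy R (Q K) = 1.
  by rewrite /Q big_geq // /abundancy /sigma big_seq1 divr1.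
have QS z : (K <= z)%N ->
    abundancy R (Q z.+1) = if prime z then (1 + z%:R^-1) * abundancy R (Q z)
                           else abundancy R (Q z).
  move=> Kz; rewrite /Q [in LHS]big_mkcond big_nat_recr //= -big_mkcond /=.
  rewrite -/(Q z); case: ifP => [pz|_]; last by rewrite muln1.
  rewrite mulnC abundancy_prime_mul // /Q big_nat_cond.
  apply: (big_ind (fun x => ~~ (z %| x)%N)).
  - by rewrite gtnNdvd ?prime_gt1.
  - by move=> x y zx zy; rewrite Euclid_dvdM // negb_or zx.
  - by move=> p /andP[/andP[_ pz'] pp]; rewrite gtnNdvd ?prime_gt0.
(* A factor 1 + 1/p adds at least 1/p, the abundancy being at least 1; by divergence the products
   pass l. *)
have Qlb i : 1 + \sum_(K <= p < K + i | prime p) p%:R^-1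
    <= abundancy R (Q (K + i)%N).
  elim: i => [|i IH]; first by rewrite addn0 big_geq // addr0 QK.
  rewrite addnS QS ?leq_addr // big_mkcond big_nat_recr ?leq_addr //=.
  rewrite -big_mkcond /=; case: ifP => _; last by rewrite addr0.
  rewrite addrA mulrDl mul1r lerD // ler_peMr ?invr_ge0 //.
  exact: abundancy_ge1.
have ex : exists z, (K <= z)%N && (l < abundancy R (Q z)).
  have [z [Kz hz]] := sum_prime_inv_unbounded K l.
  exists z; rewrite Kz /=; have := Qlb (z - K)%N.
  by rewrite subnKC //; apply: lt_le_trans; lra.
(* The last product before l is passed is the required m. *)
case: (ex_minnP ex) => z /andP[Kz lz] zmin.
have [zK|Kz'] := leqP z K.
  by move: lz; rewrite (_ : z = K) ?QK; [lra|apply/eqP; rewrite eqn_leq zK].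
case: z Kz lz zmin Kz' => // w _ lw wmin; rewrite ltnS => Kw.
have Qw : abundancy R (Q w) <= l.
  rewrite leNgt; apply/negP => h; have := wmin w.
  by rewrite Kw h ltnn => /(_ isT).
exists (Q w) => //; rewrite Qw andbT.
move: lw; rewrite QS //; case: ifP => _; last by rewrite ltNge Qw.
have w0 : 0 < w%:R :> R by rewrite ltr0n (leq_trans _ Kw).
have : w%:R^-1 * abundancy R (Q w) < c.
  rewrite mulrC ltr_pdivrMr // (le_lt_trans Qw) // mulrC -ltr_pdivrMr //.
  by rewrite (lt_le_trans (truncnS_gt _)) // ler_nat.
lra.
Qed.

Lemma count_abundancy_near (l c : R) : 1 <= l -> 0 < c ->
  exists eta C : R, 0 < eta /\ forall N,
    eta * N%:R - C <= (count_upto (fun n => `|abundancy R n - l| < c) N)%:R.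
Proof.
move=> l1 c0; have [m m0 /andP[lm ml]] := exists_abundancy_near l1 c0.
(* Chosen so that l (1 + t) = l + c/2. *)
pose t := c / (2 * l).
have t0 : 0 < t by rewrite divr_gt0 //; lra.
(* Makes the Markov bound 2 / (y t) at most 1/2: up to the constant [B], at least half of the j
   survive. *)
pose y := (Num.truncn (4 / t)).+1; pose M := y`!.
have y0 : (0 < y)%N by [].
(* For j >= 1 one has h j <= T j, so the first N / T terms stay below N. *)
pose h j := (m * (1 + M * j))%N; pose T := (m * M.+1)%N.
have T0 : 0 < T%:R :> R by rewrite ltr0n muln_gt0 m0.
pose B : R := ((M * y).+2)%:R / t.
have half J : 2^-1 * J%:R - B <=
    (count_upto (fun j => abundancy R (1 + M * j) <= 1 + t) J)%:R.
  have := count_upto_markov t0 _ (sum_abundancy_progression R J y0).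
  move=> /(_ _)/wrap[|hJ].
    by move=> n _; rewrite subr_ge0 abundancy_ge1.
  have : J%:R <= (count_upto (fun j => abundancy R (1 + M * j) <= 1 + t) J)%:R +
      (count_upto (fun j => (t < abundancy R (1 + M * j) - 1)%R) J)%:R :> R.
    rewrite -natrD ler_nat -[leqLHS](_ : count_upto predT J = J); last first.
      by rewrite count_upto_size filter_predT size_iota.
    apply: count_upto_subadd => n _ _.
    by have [//|] := leP (abundancy _ _) (1 + t) => /= ?; lra.
  have : 2 * (J%:R / y%:R) / t <= 2^-1 * J%:R :> R.
    rewrite ler_pdivrMr // [leLHS](_ : _ = J%:R * (2 / y%:R)); last by ring.
    rewrite [leRHS](_ : _ = J%:R * (2^-1 * t)); last by ring.
    rewrite ler_wpM2l // ler_pdivrMr ?ltr0n //.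
    have : 4 / t < y%:R := truncnS_gt _.
    by rewrite ltr_pdivrMr //; lra.
  move: hJ; rewrite mulrDl -/M -/B; lra.
exists (2^-1 / T%:R), (1 + B); split; first by rewrite divr_gt0 // ?invr_gt0.
move=> N; pose J := (N %/ T)%N.
apply: le_trans (_ : 2^-1 * J%:R - B <= _).
  have : N%:R < (J%:R + 1) * T%:R :> R.
    by rewrite natr1 -natrM ltr_nat ltn_ceil // muln_gt0 m0.
  rewrite -ltr_pdivrMr // => hN.
  by rewrite -mulrA [_^-1 * N%:R]mulrC; lra.
apply: le_trans (half J) _; rewrite ler_nat.
have [J0|J0] := posnP J; first by rewrite J0 count_upto0.
have hJN : (h J <= N)%N.
  apply: leq_trans (leq_divM N T); rewrite -/J /h /T mulnCA.
  by rewrite leq_mul2l; apply/orP; right; rewrite mulnS mulnC leq_add2r.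
rewrite -(subnKC hJN) count_uptoD; apply: leq_trans (leq_addr _ _).
apply: leq_trans (leq_count_upto_comp (fun n => `|abundancy R n - l| < c) (h := h) J _); last first.
  move=> i j ij; rewrite /h ltn_pmul2l // ltn_add2l ltn_pmul2l //.
  exact: fact_gt0.
(* f(m) <= f(h j) <= f(m) f(1 + y! j) <= l + c/2, and f(m) > l - c. *)
apply: leq_count_upto => j _ aj; rewrite /h.
have a1 := @le_abundancy_mul R m (1 + M * j) m0 isT.
have a2 := @abundancy_mul_le R m (1 + M * j) m0 isT.
have a3 : abundancy R m * abundancy R (1 + M * j) <= l * (1 + t).
  apply: ler_pM => //; first by rewrite (le_trans ler01) // abundancy_ge1.
  by rewrite (le_trans ler01) // abundancy_ge1.
have lt2 : l * t = c / 2 by rewrite /t; field; apply/lt0r_neq0; lra.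
by rewrite ltr_norml; apply/andP; split; lra.
Qed.

(** Natural density d, with an error bound valid for every N: such bounds add up without any
    tracking of thresholds. *)
Definition count_asymptotic (P : pred nat) (d : R) := forall eps, 0 < eps ->
  exists C : R, forall N, `|(count_upto P N)%:R - d * N%:R| <= eps * N%:R + C.

Lemma archi_mul_le (a b : R) : (forall N : nat, a * N%:R <= b) -> a <= 0.
Proof.
move=> h; rewrite leNgt; apply/negP => a0.
have := h (Num.truncn (b / a)).+1; rewrite mulrC -ler_pdivlMr // leNgt.
by rewrite truncnS_gt.
Qed.

(** The density is the supremum of the slopes x for which x N - C stays below the count. An
    approximate slope d with error e confines it between d - e and d + e, which gives
    completeness. *)
Lemma ex_count_asymptotic (P : pred nat) :
  (forall eps, 0 < eps -> exists d C : R, forall N,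
    `|(count_upto P N)%:R - d * N%:R| <= eps * N%:R + C) ->
  exists d, count_asymptotic P d.
Proof.
move=> approx.
pose S : set R := [set x | exists C : R, forall N, x * N%:R - C <= (count_upto P N)%:R].
have S0 : S 0.
  by exists 0 => N; rewrite mul0r subr0.
have Sub d e C x : (forall N, `|(count_upto P N)%:R - d * N%:R| <= e * N%:R + C) ->
    S x -> x <= d + e.
  move=> hd [C' hx]; rewrite -subr_le0; apply: (@archi_mul_le _ (C + C')) => N.
  by have := hx N; have := hd N; rewrite ler_norml => /andP[_]; lra.
have [d1 [C1 h1]] := approx 1 ltr01.
have hS : has_sup S.
  by split; [exists 0|exists (d1 + 1) => x; apply: Sub h1].
exists (sup S) => e e0; have e2 : 0 < e / 2 by rewrite divr_gt0.
have [d [C hd]] := approx _ e2.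
have up : sup S <= d + e / 2.
  by apply: ge_sup; [exists 0|move=> x; apply: Sub hd].
have lo : d - e / 2 <= sup S.
  apply: ub_le_sup; first by case: hS.
  by exists C => N; have := hd N; rewrite ler_norml => /andP[+ _]; lra.
exists C => N; have := hd N.
have : `|(d - sup S) * N%:R| <= e / 2 * N%:R.
  rewrite normrM [ `|N%:R|]ger0_norm // ler_wpM2r //.
  by rewrite ler_norml; apply/andP; split; lra.
by rewrite !ler_norml => /andP[? ?] /andP[? ?]; apply/andP; split; lra.
Qed.

Lemma count_asymptotic_cvg P d : count_asymptotic P d ->
  (count_upto P (Num.truncn x))%:R / x @[x --> +oo%R] --> d.
Proof.
move=> h; apply/cvgrPdist_le => e e0.
have e2 : 0 < e / 2 by rewrite divr_gt0.
have [C hC] := h _ e2.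
near=> x.
have x1 : 1 <= x by near: x; apply: nbhs_pinfty_ge; rewrite num_real.
(* From here on e x / 2 absorbs both C and the cost of replacing the integer part of x by x, which
   is at most |d|. *)
have xC : (C + `|d|) / (e / 2) <= x.
  by near: x; apply: nbhs_pinfty_ge; rewrite num_real.
have x0 : 0 < x by lra.
have := hC (Num.truncn x); have /truncn_itv/andP[Nx xN] : 0 <= x by lra.
move: (Num.truncn x) Nx xN => N Nx; rewrite -natr1 => xN hN.
rewrite ler_pdivrMr // in xC.
have -> : d - (count_upto P N)%:R / x = (d * x - (count_upto P N)%:R) / x.
  by field; apply: lt0r_neq0.
rewrite normrM normfV [ `|x|]gtr0_norm // ler_pdivrMr //.
have : `|d * (x - N%:R)| <= `|d|.
  rewrite normrM -[leRHS]mulr1 ler_wpM2l //.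
  by rewrite ler_norml; apply/andP; split; lra.
have : e / 2 * N%:R <= e / 2 * x by rewrite ler_wpM2l // ltW.
move: hN; rewrite !ler_norml.
by move=> /andP[? ?] ? /andP[? ?]; apply/andP; split; lra.
Unshelve. all: by end_near.
Qed.

Lemma counting_count_upto (A : set nat) (x : R) :
  Defs.counting A x = count_upto (fun n => n \in A) (Num.truncn x).
Proof. by []. Qed.

Lemma count_asymptotic_density (A : set nat) d :
  count_asymptotic (fun n => n \in A) d -> has_density A d.
Proof.
move=> /count_asymptotic_cvg h; apply: (cvg_comp _ _ _ h).
exact: cvgr_idn.
Qed.

(** This contains the existence part of Davenport's theorem: for u >= 1 the limit is shown to exist,
    so [lim] is not a default value; for u < 1 no n is counted. *)
Lemma count_asymptotic_sigma_distr (u : R) :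
  count_asymptotic (fun n => abundancy R n <= u) (sigma_distr u).
Proof.
rewrite /sigma_distr; case: ltP => u1.
  move=> e e0; exists 0 => N.
  have -> : count_upto (fun n => abundancy R n <= u) N = 0%N.
    rewrite /count_upto big_nat big1 // => n /andP[n0 _].
    by rewrite leNgt (lt_le_trans u1) ?abundancy_ge1.
  by rewrite mul0r subr0 normr0 addr0 mulr_ge0 // ltW.
have [d hd] := ex_count_asymptotic (@count_abundancy_approx R u).
suff -> : lim (prop_upto [set n : nat | (sigma n)%:R / n%:R <= u] x
    @[x --> +oo%R]) = d by [].
apply: cvg_lim => //; apply: cvg_trans (count_asymptotic_cvg hd).
apply: near_eq_cvg; apply: nearW => x.
rewrite /prop_upto counting_count_upto; congr (_%:R / _).
by apply: eq_count_upto => n _; apply/idP/idP; rewrite inE.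
Qed.

(** The exceptional set may vary with eps; concentration sets and initial segments n < n0 enter in
    this way. *)
Lemma count_asymptotic_perturb (P Q : pred nat) d : count_asymptotic Q d ->
  (forall eps, 0 < eps -> exists (B : pred nat) (C : R), [/\
    forall n, (0 < n)%N -> P n -> Q n || B n,
    forall n, (0 < n)%N -> Q n -> P n || B n &
    forall N, (count_upto B N)%:R <= eps * N%:R + C]) ->
  count_asymptotic P d.
Proof.
move=> hQ hB e e0; have e2 : 0 < e / 2 by rewrite divr_gt0.
have [C1 h1] := hQ _ e2; have [B [C2 [PQ QP h2]]] := hB _ e2.
exists (C1 + C2) => N; have := h1 N; have := h2 N.
have : (count_upto P N)%:R <= (count_upto Q N)%:R + (count_upto B N)%:R :> R.
  rewrite -natrD ler_nat; apply: count_upto_subadd => n /andP[n0 _]; exact: PQ.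
have : (count_upto Q N)%:R <= (count_upto P N)%:R + (count_upto B N)%:R :> R.
  rewrite -natrD ler_nat; apply: count_upto_subadd => n /andP[n0 _]; exact: QP.
by rewrite !ler_norml => ? ? ? /andP[? ?]; apply/andP; split; lra.
Qed.

Lemma count_upto_or P Q N :
  (count_upto (fun n => P n || Q n) N)%:R <=
    (count_upto P N)%:R + (count_upto Q N)%:R :> R.
Proof. by rewrite -natrD ler_nat; apply: count_upto_subadd. Qed.

Lemma count_upto_lt n0 N : (count_upto (fun n => (n < n0)%N) N)%:R <= n0%:R :> R.
Proof.
rewrite ler_nat; elim: N => [|N IH]; first by rewrite count_upto0.
rewrite count_uptoS; case: ltnP => h; last by rewrite addn0.
by rewrite addn1 (leq_trans _ h) // ltnS ltnW // ltnS count_upto_leq.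
Qed.

Lemma prop_upto_bounded (A : set nat) :
  bounded_fun (fun N : nat => prop_upto A (N%:R : R)).
Proof.
exists 1; split => // M M1 N _ /=; apply: le_trans (ltW M1).
rewrite /prop_upto counting_count_upto natrK.
(* At N = 0 the proportion is 0, by the convention on division by zero. *)
have [->|N0] := posnP N; first by rewrite invr0 mulr0 normr0.
rewrite ger0_norm ?divr_ge0 // ler_pdivrMr ?ltr0n // mul1r ler_nat.
exact: count_upto_leq.
Qed.

Lemma limn_inf_ge (u : nat -> R) (a : R) n0 : bounded_fun u ->
  (forall n, (n0 <= n)%N -> a <= u n) -> a <= limn_inf u.
Proof.
move=> bu h; rewrite limn_infE //.
apply: le_trans (_ : infs u n0 <= _).
  apply: lb_le_inf; first by exists (u n0), n0 => /=.
  by move=> _ [n /= n0n <-]; apply: h.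
by apply: ub_le_sup; [exact: bounded_fun_has_ubound_infs|exists n0].
Qed.

Lemma limn_sup_le (u : nat -> R) (a : R) n0 : bounded_fun u ->
  (forall n, (n0 <= n)%N -> u n <= a) -> limn_sup u <= a.
Proof.
move=> bu h; rewrite limn_supE //.
apply: le_trans (_ : sups u n0 <= _).
  by apply: ge_inf; [exact: bounded_fun_has_lbound_sups|exists n0].
apply: ge_sup; first by exists (u n0), n0 => /=.
by move=> _ [n /= n0n <-]; apply: h.
Qed.

Lemma lower_density_gt0 (A : set nat) (eta C : R) : 0 < eta ->
  (forall N, eta * N%:R - C <= (count_upto (fun n => n \in A) N)%:R) ->
  0 < lower_density R A.
Proof.
move=> e0 h; apply: lt_le_trans (_ : eta / 2 <= _); first by rewrite divr_gt0.
(* Beyond this index C is less than eta N / 2. *)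
apply: (@limn_inf_ge _ _ (Num.truncn (C / (eta / 2))).+1).
  exact: prop_upto_bounded.
move=> N hN; rewrite /prop_upto counting_count_upto natrK.
have N0 : 0 < N%:R :> R by rewrite ltr0n (leq_trans _ hN).
rewrite ler_pdivlMr //; apply: le_trans (h N).
have : C / (eta / 2) < N%:R.
  by rewrite (lt_le_trans (truncnS_gt _)) // ler_nat.
rewrite ltr_pdivrMr ?divr_gt0 //; lra.
Qed.

Lemma upper_density_lt1 (A : set nat) (P : pred nat) (eta C : R) : 0 < eta ->
  (forall N, (count_upto (fun n => n \in A) N)%:R + (count_upto P N)%:R
    <= N%:R + C) ->
  (forall N, eta * N%:R - C <= (count_upto P N)%:R) ->
  upper_density R A < 1.
Proof.
move=> e0 hA h; apply: le_lt_trans (_ : 1 - eta / 2 < 1); last first.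
  by rewrite gtrBl divr_gt0.
(* The constant C is lost once in each hypothesis, hence the 2 C. *)
apply: (@limn_sup_le _ _ (Num.truncn (2 * C / (eta / 2))).+1).
  exact: prop_upto_bounded.
move=> N hN; rewrite /prop_upto counting_count_upto natrK.
have N0 : 0 < N%:R :> R by rewrite ltr0n (leq_trans _ hN).
rewrite ler_pdivrMr //.
have : 2 * C / (eta / 2) < N%:R.
  by rewrite (lt_le_trans (truncnS_gt _)) // ler_nat.
rewrite ltr_pdivrMr ?divr_gt0 //; have := hA N; have := h N; lra.
Qed.

Lemma mem_within_perfect (l : R) (k : R -> R) n : (0 < n)%N ->
  (n \in within_perfect l k) = (`|abundancy R n - l| * n%:R < k n%:R).
Proof.
move=> n0; have nR : 0 < n%:R :> R by rewrite ltr0n.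
have -> : `|abundancy R n - l| * n%:R = `|(sigma n)%:R - l * n%:R|.
  rewrite -[X in _ * X](gtr0_norm nR) -normrM /abundancy mulrBl mulfVK //.
  exact: lt0r_neq0.
by apply/idP/idP; rewrite inE => // -[].
Qed.

End Density.

(** * The four regimes of growth of [k] *)

Theorem theorem1p1 (R : realType) (l : R) (k : R -> R)
    (hl : 1 <= l)
    (kpos : forall x : R, 1 <= x -> 0 < k x)
    (kincr : forall x y : R, 1 <= x -> x <= y -> k x <= k y) :
  [/\ (fun n : nat => k n%:R) =o_\oo (fun n : nat => n%:R : R) ->
        has_density (within_perfect l k) (0 : R),
      forall c : R, 0 < c ->
        (fun n : nat => k n%:R) ~_\oo (fun n : nat => c * n%:R) ->
        has_density (within_perfect l k)
          (sigma_distr (l + c) - sigma_distr (l - c)),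
      asymp (fun n : nat => k n%:R) (fun n : nat => n%:R) ->
        0 < lower_density R (within_perfect l k) /\
        upper_density R (within_perfect l k) < 1 &
      (fun n : nat => n%:R : R) =o_\oo (fun n : nat => k n%:R) ->
        has_density (within_perfect l k) (1 : R)].
Proof.
pose W n := n \in within_perfect l k; pose f := abundancy R.
have WE n : (0 < n)%N -> W n = (`|f n - l| * n%:R < k n%:R).
  exact: mem_within_perfect.
split.
(* For large n, k(n) <= delta n confines f(n) to the interval of radius delta about l, where f does
   not concentrate. *)
- move=> /eqoP ko; apply: count_asymptotic_density.
  apply: (@count_asymptotic_perturb _ _ pred0).
    by move=> e e0; exists 0 => N; rewrite /count_upto big1 // mul0r subr0 normr0
      addr0 mulr_ge0 // ltW.
  move=> e e0; have [delta d0 [C hC]] := abundancy_concentration l e0.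
  have [n0 _ hk] := ko _ d0.
  exists (fun n => (`|f n - l| <= delta) || (n < n0)%N), (C + n0%:R); split => //.
    move=> n npos; rewrite -/(W n) WE //=; have [n0n|] := leqP n0 n; last by rewrite orbT.
    have nR : 0 < n%:R :> R by rewrite ltr0n.
    rewrite orbF -(ler_pM2r nR) => /ltW /le_trans; apply.
    have := hk n n0n; rewrite /= [ `|n%:R|]ger0_norm //.
    by apply: le_trans; apply: ler_norm.
  move=> N; apply: le_trans (count_upto_or _ _ _ _) _.
  by rewrite addrA lerD // ?count_upto_lt.
- move=> c c0 /eqaddoP kc; apply: count_asymptotic_density.
  (* [Q] has density D(l + c) - D(l - c), and for large n it differs from [W] only where f(n) is
     close to l + c or l - c. *)
  pose Q n := (f n <= l + c) && ~~ (f n <= l - c).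
  apply: (@count_asymptotic_perturb _ _ Q).
    move=> e e0; have e2 : 0 < e / 2 by rewrite divr_gt0.
    have [C1 h1] := count_asymptotic_sigma_distr (l + c) e2.
    have [C2 h2] := count_asymptotic_sigma_distr (l - c) e2.
    exists (C1 + C2) => N; have := h1 N; have := h2 N.
    have -> : count_upto (fun n => abundancy R n <= l + c) N =
        (count_upto Q N + count_upto (fun n => (abundancy R n <= l - c)%R) N)%N.
      rewrite /count_upto -big_split; apply: eq_bigr => n _ /=.
      rewrite /Q /f; have [h|_] := leP (abundancy R n) (l - c).
        by rewrite andbF (le_trans h) // lerD2l; lra.
      by rewrite andbT addn0.
    rewrite natrD !ler_norml => /andP[? ?] /andP[? ?]; apply/andP; split; lra.
  move=> e e0; have e2 : 0 < e / 2 by rewrite divr_gt0.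
  have [da da0 [Ca hCa]] := abundancy_concentration (l + c) e2.
  have [db db0 [Cb hCb]] := abundancy_concentration (l - c) e2.
  pose d := Num.min da db; have d0 : 0 < d by rewrite lt_min da0.
  (* A relative error d/c of c n is an absolute error d n. *)
  have [n0 _ hk] := kc _ (divr_gt0 d0 c0).
  pose B1 n := `|f n - (l + c)| <= da; pose B2 n := `|f n - (l - c)| <= db.
  have hkn n : (n0 <= n)%N -> (0 < n)%N ->
      (c - d) * n%:R <= k n%:R <= (c + d) * n%:R.
    move=> n0n npos.
    have : `|k n%:R - c * n%:R| <= d / c * `|c * n%:R| := hk n n0n.
    rewrite [ `|c * _|]ger0_norm; last by rewrite mulr_ge0 // ltW.
    rewrite mulrA divfK ?lt0r_neq0 // ler_norml => /andP[h1 h2].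
    by apply/andP; split; lra.
  have dab : d <= da /\ d <= db by rewrite /d !ge_min !lexx orbT.
  exists (fun n => (B1 n || B2 n) || (n < n0)%N), (Ca + Cb + n0%:R); split.
  + move=> n npos; rewrite -/(W n) WE //=.
    have [n0n|] := leqP n0 n; last by rewrite !orbT.
    have nR : 0 < n%:R :> R by rewrite ltr0n.
    have /andP[_ h2] := hkn n n0n npos.
    move=> /lt_le_trans /(_ h2); rewrite ltr_pM2r // orbF ltr_norml /Q /B1 /B2.
    move=> /andP[h3 h4]; rewrite !ler_norml.
    have [h5|h5] := leP (f n) (l + c); have [h6|h6] := leP (f n) (l - c) => //=.
    * by apply/orP; right; apply/andP; split; lra.
    * lra.
    * by apply/orP; left; apply/andP; split; lra.
  + move=> n npos; rewrite -/(W n) WE //= /Q => /andP[h1]; rewrite -ltNge => h2.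
    have [n0n|] := leqP n0 n; last by rewrite !orbT.
    have nR : 0 < n%:R :> R by rewrite ltr0n.
    have /andP[h3 _] := hkn n n0n npos.
    rewrite orbF; have [//|h4] := ltP (`|f n - l| * n%:R) (k n%:R) => /=.
    have : c - d <= `|f n - l| by rewrite -(ler_pM2r nR) (le_trans h3).
    rewrite /B1 /B2 !ler_norml ler_normr => /orP[h5|h5]; apply/orP.
      by left; apply/andP; split; lra.
    by right; apply/andP; split; lra.
  + move=> N; apply: le_trans (count_upto_or _ _ _ _) _.
    apply: le_trans (lerD (count_upto_or _ _ _ _) (count_upto_lt _ _ _)) _.
    by have := hCa N; have := hCb N; rewrite /B1 /B2 /f; lra.
(* Up to finitely many n, [W] contains the n with |f(n) - l| < c1. *)
- move=> [c1 [c2 [c10 c20 [n0 _ hk]]]]; split.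
    have [eta [C [eta0 hC]]] := count_abundancy_near hl c10.
    apply: (@lower_density_gt0 _ _ eta (C + n0%:R)) => // N.
    have : (count_upto (fun n => `|abundancy R n - l| < c1) N)%:R <=
        (count_upto W N)%:R + (count_upto (fun n => (n < n0)%N) N)%:R :> R.
      rewrite -natrD ler_nat; apply: count_upto_subadd => n /andP[npos _] h.
      rewrite WE //; have [n0n|] := leqP n0 n; last by rewrite orbT.
      have nR : 0 < n%:R :> R by rewrite ltr0n.
      have [/= h1 _] := hk n n0n.
      by rewrite orbF (lt_trans _ h1) // ltr_pM2r.
    have := hC N; have := count_upto_lt R n0 N; rewrite /W; lra.
  (* Values within 1 of l + c2 + 1 exceed l + c2, so for large n they lie outside [W]; they fill a
     positive proportion. *)
  have hl' : 1 <= l + c2 + 1 by lra.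
  have [eta [C [eta0 hC]]] := count_abundancy_near hl' ltr01.
  pose P n := `|abundancy R n - (l + c2 + 1)| < 1.
  have hWP N : (count_upto W N)%:R + (count_upto P N)%:R <= N%:R + n0%:R :> R.
    apply: le_trans (_ : N%:R + (count_upto (fun n => (n < n0)%N) N)%:R <= _);
      last by rewrite lerD2l count_upto_lt.
    rewrite -!natrD ler_nat -[X in (_ <= X + _)%N](_ : count_upto predT N = N);
      last by rewrite count_upto_size filter_predT size_iota.
    rewrite /count_upto -!big_split /= !big_nat.
    apply: leq_sum => n /andP[npos _].
    have [n0n|_] := leqP n0 n; last by case: (W n) (P n) => [] [].
    have [h|//] := boolP (P n); last by case: (W n).
    suff /negbTE -> : ~~ W n by [].
    rewrite WE // -leNgt; have [_ /= h2] := hk n n0n.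
    have nR : 0 < n%:R :> R by rewrite ltr0n.
    apply: le_trans (ltW h2) _; rewrite ler_pM2r //.
    move: h; rewrite /P /f ltr_norml ler_normr => /andP[h3 h4].
    by apply/orP; left; lra.
  (* One constant has to serve both bounds, and C may be negative, hence its absolute value. *)
  apply: (@upper_density_lt1 _ _ P eta (`|C| + n0%:R)) => // N.
    by apply: le_trans (hWP N) _; rewrite lerD2l lerDr.
  apply: le_trans (hC N); rewrite lerD2l lerN2.
  by rewrite (le_trans (ler_norm C)) // lerDl.
- move=> /eqoP nk; apply: count_asymptotic_density.
  apply: (@count_asymptotic_perturb _ _ predT).
    move=> e e0; exists 0 => N.
    by rewrite count_upto_size filter_predT size_iota mul1r subrr normr0 addr0 mulr_ge0 // ltW.
  (* f(n) > 1 + 1/e holds for a proportion of at most e; otherwise |f(n) - l| < T, and T n <= k(n)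
     for large n. *)
  move=> e e0; have A0 : 0 < e^-1 by rewrite invr_gt0.
  pose T := l + 1 + e^-1; have T0 : 0 < T by rewrite /T; lra.
  have [n0 _ hk] := nk T^-1 (etrans (invr_gt0 T) T0).
  exists (fun n => (1 + e^-1 < f n) || (n < n0)%N), n0%:R; split => //.
    move=> n npos _; rewrite -/(W n) WE //.
    have [n0n|] := leqP n0 n; last by rewrite !orbT.
    have [_|fn] := ltP (1 + e^-1) (f n); first by rewrite !orbT.
    have nR : 0 < n%:R :> R by rewrite ltr0n.
    have kn : 0 < k n%:R by rewrite kpos // ler1n.
    have : `|n%:R| <= T^-1 * `|k n%:R| := hk n n0n.
    rewrite (gtr0_norm nR) (gtr0_norm kn) mulrC ler_pdivlMr // => h.
    rewrite !orbF; apply: lt_le_trans h; rewrite mulrC ltr_pM2l //.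
    have := abundancy_ge1 R npos; rewrite -/(f n) => f1.
    by rewrite ltr_norml /T; apply/andP; split; lra.
  move=> N; apply: le_trans (count_upto_or _ _ _ _) _.
  apply: lerD; last exact: count_upto_lt.
  by have := count_abundancy_gt N A0; rewrite invrK mulrC.
Qed.
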